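(* Let $Q$ be a finite quiver and $\mathbf d$ a dimension vector with $q(\mathbf d)=1$ such that the general representation in $\mathrm{Rep}(Q,\mathbf d)$ is indecomposable. Let $D\subset\mathrm{Rep}(Q,\mathbf d)$ be the discriminant, i.e. the divisor defined by $\Delta=\det(\tilde d^M_M)$. If $D$ is reduced (i.e. $\Delta$ is squarefree), then $D$ is a linear free divisor.
   Context: $k$ is an algebraically closed field of characteristic zero. A quiver $Q$ is a finite directed graph with node set $Q_0$, arrow set $Q_1$, and head and tail maps $h,t:Q_1\to Q_0$. For $\mathbf d\in\mathbb N^{Q_0}$, $\mathrm{Rep}(Q,\mathbf d)=\prod_{\varphi\in Q_1}\mathrm{Hom}_k(k^{\mathbf d(t\varphi)},k^{\mathbf d(h\varphi)})$. The Tits form is $q(\mathbf d)=\sum_{x}\mathbf d(x)^2-\sum_{\varphi}\mathbf d(t\varphi)\mathbf d(h\varphi)$. $R=k[\mathrm{Rep}(Q,\mathbf d)]$ is the polynomial coordinate ring; $\theta_R=\mathrm{Der}_k(R)\cong\mathrm{Rep}(Q,\mathbf d)\otimes_kR$; $\mathfrak{gl}(Q,\mathbf d)=\prod_x\mathrm{End}(k^{\mathbf d(x)})$; $\mathfrak{pgl}(Q,\mathbf d)=\mathfrak{gl}(Q,\mathbf d)/k$ (quotient by diagonal scalars). The universal representation $M$ has as matrices $M(\varphi)$ the matrices of coordinate functions. The map $\tilde d^M_M:\mathfrak{pgl}(Q,\mathbf d)\otimes_kR\to\theta_R$ is induced by $(\psi_x)_x\mapsto(\psi_{h\varphi}M(\varphi)-M(\varphi)\psi_{t\varphi})_{\varphi}$.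 When $q(\mathbf d)=1$, source and target are free $R$-modules of equal rank, so $\Delta=\det(\tilde d^M_M)\in R$ is defined up to a nonzero scalar. The zero set of $\Delta$ is the set of non-rigid representations ($\mathrm{Ext}^1_Q(V,V)\ne0$). A reduced hypersurface $D$ in an affine space with coordinate ring $R$ is a free divisor if $\mathrm{Der}(-\log D)=\{\chi\in\mathrm{Der}_k(R):\chi(I_D)\subseteq I_D\}$ is a (locally) free $R$-module. It is a linear free divisor if $\mathrm{Der}(-\log D)$ has a basis of vector fields all of whose coefficients are linear forms in the coordinates. *)

(* Defs.v *)
From HB Require Import structures.
From mathcomp Require Import all_boot all_order all_algebra.
From mathcomp Require Export mpoly.
Set Implicit Arguments.
Unset Strict Implicit.
Unset Printing Implicit Defensive.
Import GRing.Theory.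
Local Open Scope ring_scope.

(** * Quivers and representations *)

(* Loops, multiple arrows and oriented cycles are allowed. *)
Record quiver := Quiver {
  node : finType;
  arrow : finType;
  head : arrow -> node;
  tail : arrow -> node
}.

Definition dimvec (Q : quiver) := node Q -> nat.

Definition tits_form (Q : quiver) (d : dimvec Q) : int :=
  \sum_(x : node Q) (d x)%:Z ^+ 2
  - \sum_(a : arrow Q) (d (tail a))%:Z * (d (head a))%:Z.

(* Matrices act on column vectors. *)
Definition Rep (A : Type) (Q : quiver) (d : dimvec Q) : Type :=
  forall a : arrow Q, 'M[A]_(d (head a), d (tail a)).

Definition gl (A : Type) (Q : quiver) (d : dimvec Q) : Type :=
  forall x : node Q, 'M[A]_(d x).

Section Indecomposable.
Variables (k : fieldType) (Q : quiver) (d : dimvec Q).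

Definition subspaces : Type := forall x : node Q, {vspace 'cV[k]_(d x)}.

Definition subrep (V : Rep k d) (W : subspaces) : Prop :=
  forall (a : arrow Q) (v : 'cV[k]_(d (tail a))),
    v \in W (tail a) -> V a *m v \in W (head a).

Definition direct_sum (U W : subspaces) : Prop :=
  forall x, (U x + W x)%VS = fullv /\ (U x :&: W x)%VS = 0%VS.

Definition indecomposable (V : Rep k d) : Prop :=
  (exists x, d x <> 0%N) /\
  forall U W : subspaces, subrep V U -> subrep V W -> direct_sum U W ->
    (forall x, U x = 0%VS) \/ (forall x, W x = 0%VS).

End Indecomposable.

(** * The coordinate ring of Rep(Q,d) *)

(* The coordinate functions: one for each entry of each matrix. *)
Definition coord (Q : quiver) (d : dimvec Q) : finType :=
  {a : arrow Q & ('I_(d (head a)) * 'I_(d (tail a)))%type}.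

Definition ncoord (Q : quiver) (d : dimvec Q) : nat := #|coord d|.

Notation coord_ring k d := {mpoly k[ncoord d]}.

Definition entry (A : Type) (Q : quiver) (d : dimvec Q) (V : Rep A d)
    (c : coord d) : A :=
  V (tag c) (tagged c).1 (tagged c).2.

Definition coords (A : Type) (Q : quiver) (d : dimvec Q) (V : Rep A d)
    (i : 'I_(ncoord d)) : A :=
  entry V (enum_val i).

Section Generic.
Variables (k : fieldType) (Q : quiver) (d : dimvec Q).

Definition zariski_open (U : Rep k d -> Prop) : Prop :=
  exists S : coord_ring k d -> Prop,
    forall V : Rep k d, U V <-> exists f, S f /\ f.@[coords V] <> 0.

Definition general (P : Rep k d -> Prop) : Prop :=
  exists U : Rep k d -> Prop,
    [/\ zariski_open U, exists V, U V & forall V, U V -> P V].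

End Generic.

(** * The discriminant *)

Section Discriminant.
Variables (k : fieldType) (Q : quiver) (d : dimvec Q).
Local Notation R := (coord_ring k d).

Definition universal_rep : Rep R d :=
  fun a => \matrix_(i, j)
    'X_(enum_rank (Tagged (fun a => 'I_(d (head a)) * 'I_(d (tail a)))%type
                          (i, j)) : 'I_(ncoord d)).

(* The map before passing to the quotient by the diagonal scalars, which it
   kills. *)
Definition dMM (psi : gl R d) : Rep R d :=
  fun a => psi (head a) *m universal_rep a - universal_rep a *m psi (tail a).

Definition gl_extend (psi : gl k d) : gl R d :=
  fun x => map_mx (@mpolyC (ncoord d) k) (psi x).

(* The classes of the b i form a basis of pgl(Q,d) = gl(Q,d)/k. *)
Definition pgl_basis (m : nat) (b : 'I_m -> gl k d) : Prop :=
  forall psi : gl k d, exists! c : {ffun 'I_m -> k},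
    exists l : k, forall x, psi x = \sum_(i < m) c i *: b i x + l%:M.

(* Matrix of pgl(Q,d) (x) R -> theta_R with respect to the basis of classes of
   the b j and the basis of coordinate vector fields. *)
Definition dMM_matrix (b : 'I_(ncoord d) -> gl k d) : 'M[R]_(ncoord d) :=
  \matrix_(i, j) coords (dMM (gl_extend (b j))) i.

(* A square matrix requires dim pgl(Q,d) = dim Rep(Q,d), which for d <> 0 means
   that the Tits form takes the value 1; another basis of pgl(Q,d) multiplies
   the determinant by a nonzero scalar. *)
Definition discriminant (b : 'I_(ncoord d) -> gl k d) : R :=
  \det (dMM_matrix b).

End Discriminant.

(** * Logarithmic vector fields and linear free divisors *)

Section FreeDivisor.
Variables (k : fieldType) (n : nat).
Local Notation R := {mpoly k[n]}.

(* 0 is not squarefree; units are, and they define the empty divisor. *)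
Definition squarefree (f : R) : Prop :=
  forall g h : R, f = g ^+ 2 * h -> g \is a GRing.unit.

Definition principal (f : R) : R -> Prop := fun g => exists h, g = h * f.

Definition reduced_hypersurface (I : R -> Prop) : Prop :=
  exists f : R, [/\ f <> 0, squarefree f & forall g, I g <-> principal f g].

Definition derivation (chi : R -> R) : Prop :=
  linear chi /\ forall f g, chi (f * g) = chi f * g + f * chi g.

(* Der(-log D), where I is the ideal of D. *)
Definition Der_log (I : R -> Prop) (chi : R -> R) : Prop :=
  derivation chi /\ forall f, I f -> I (chi f).

Definition module_basis (L : (R -> R) -> Prop) (m : nat)
    (e : 'I_m -> R -> R) : Prop :=
  (forall i, L (e i)) /\
  forall chi, L chi -> exists! c : {ffun 'I_m -> R},
    forall f, chi f = \sum_(i < m) c i * e i f.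

(* The coefficient of d/dx_j in chi is chi(x_j). *)
Definition linear_vector_field (chi : R -> R) : Prop :=
  forall j : 'I_n, chi 'X_j \is 1.-homog.

Definition linear_free_divisor (I : R -> Prop) : Prop :=
  reduced_hypersurface I /\
  exists (m : nat) (e : 'I_m -> R -> R),
    module_basis (Der_log I) e /\ forall i, linear_vector_field (e i).

End FreeDivisor.

(* Main.v *)
From HB Require Import structures.
Require Import Defs.
From mathcomp Require Import all_boot all_order all_algebra ring.
From Stdlib Require Import Classical.
Set Implicit Arguments.
Unset Strict Implicit.
Unset Printing Implicit Defensive.
Import GRing.Theory.
Local Open Scope ring_scope.

(* The columns of [dMM_matrix b] are the linear vector fields xi_j through which
   gl(Q,d) acts on Rep(Q,d).  As they span a Lie algebra over k, the field xi_j
   maps the matrix A of all these fields to M A + A C with M and C constant, so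
   by Jacobi's formula xi_j(Delta) = (tr M + tr C) Delta: the xi_j are
   logarithmic.  Saito's criterion then makes them a basis of Der(-log D).  For
   a logarithmic field v, replacing a column of A by v gives a matrix whose
   determinant is divisible by Delta: times the gradient of Delta it is, and
   Delta is squarefree in a factorial ring of characteristic zero.  Cramer's
   rule then writes v as a combination of the xi_j.  A squarefree Delta is
   nonzero. *)

(** * Factoriality of polynomial rings *)

Definition divides (R : comNzRingType) (a b : R) : Prop := exists c, b = c * a.

Section Divides.
Variable R : comNzRingType.
Implicit Types a b c : R.

Lemma divides_refl a : divides a a.
Proof. by exists 1; rewrite mul1r. Qed.

Lemma divides_mull a b c : divides a b -> divides a (c * b).
Proof. by case=> x ->; exists (c * x); rewrite mulrA. Qed.

Lemma divides_mulr a b c : divides a b -> divides a (b * c).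
Proof. by rewrite mulrC; apply: divides_mull. Qed.

Lemma divides_trans b a c : divides a b -> divides b c -> divides a c.
Proof. by move=> ab [x ->]; apply: divides_mull. Qed.

Lemma divides_add a b c : divides a b -> divides a c -> divides a (b + c).
Proof. by move=> [x ->] [y ->]; exists (x + y); rewrite mulrDl. Qed.

Lemma divides_sub a b c : divides a b -> divides a c -> divides a (b - c).
Proof. by move=> [x ->] [y ->]; exists (x - y); rewrite mulrBl. Qed.

Lemma divides_sum a (I : finType) (F : I -> R) :
  (forall i, divides a (F i)) -> divides a (\sum_i F i).
Proof.
move=> aF; elim/big_ind: _ => //; last exact: divides_add.
by exists 0; rewrite mul0r.
Qed.

End Divides.

(** * Factorial domains *)

Section UFD.
Variable R : idomainType.
Implicit Types a b c p : R.

Definition irreducible_elt a : Prop :=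
  [/\ a != 0, a \isn't a GRing.unit &
      forall b c, a = b * c -> b \is a GRing.unit \/ c \is a GRing.unit].

Definition prime_elt a : Prop :=
  [/\ a != 0, a \isn't a GRing.unit &
      forall b c, divides a (b * c) -> divides a b \/ divides a c].

Definition additive_norm (N : R -> nat) : Prop :=
  (forall a b, a != 0 -> b != 0 -> N (a * b) = (N a + N b)%N) /\
  (forall a, a != 0 -> N a = 0%N -> a \is a GRing.unit).

(* The norm bounds the length of a factorization; it replaces the ascending
   chain condition on principal ideals. *)
Definition ufd : Prop :=
  (exists N, additive_norm N) /\ forall a, irreducible_elt a -> prime_elt a.

(** Induction on the norm: a reducible element is a product of two nonunits, and the second has
    positive norm, so the first has smaller norm. *)
Lemma irreducible_factor a : (exists N, additive_norm N) ->
  a != 0 -> a \isn't a GRing.unit ->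
  exists p c, irreducible_elt p /\ a = p * c.
Proof.
case=> N [NM N0]; have [m] := ubnP (N a).
elim: m a => // m IH a; rewrite ltnS => Nam a0 aU.
case: (classic (irreducible_elt a)) => [irr|red].
  by exists a, 1; rewrite mulr1.
have [b [c [abc bU cU]]] : exists b c,
    [/\ a = b * c, b \isn't a GRing.unit & c \isn't a GRing.unit].
  apply: NNPP => no; apply: red; split=> // b c abc.
  have [bU|bU] := boolP (b \is a GRing.unit); first by left.
  have [cU|cU] := boolP (c \is a GRing.unit); first by right.
  by case: no; exists b, c.
have /andP[b0 c0] : (b != 0) && (c != 0) by rewrite -negb_or -mulf_eq0 -abc.
have Nc : (0 < N c)%N by rewrite lt0n; apply: contraNneq cU => /(N0 _ c0).
have [|p [x [irr bE]]] := IH b _ b0 bU.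
  by apply: leq_trans Nam; rewrite abc NM // -addn1 leq_add2l.
by exists p, (x * c); rewrite mulrA -bE.
Qed.

(** Stands in for writing an element as a product of primes: later proofs remove one prime factor at
    a time. *)
Lemma ufd_ind (P : R -> Prop) : ufd ->
  (forall u, u \is a GRing.unit -> P u) ->
  (forall p a, prime_elt p -> a != 0 -> P a -> P (p * a)) ->
  forall a, a != 0 -> P a.
Proof.
move=> [exN irrP] Pu Pp a; have [N [NM N0]] := exN.
have [m] := ubnP (N a); elim: m a => // m IH a; rewrite ltnS => Nam a0.
have [/Pu//|aU] := boolP (a \is a GRing.unit).
have [p [c [/irrP pp aE]]] := irreducible_factor exN a0 aU.
have [p0 pU _] := pp.
have c0 : c != 0 by apply: contraNneq a0 => c0; rewrite aE c0 mulr0.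
rewrite aE; apply: Pp => //; apply: IH => //.
apply: leq_trans Nam; rewrite aE NM // -add1n leq_add2r lt0n.
by apply: contraNneq pU => /(N0 _ p0).
Qed.

End UFD.

(** The norm is pulled back along [f]; units and divisibility are preserved and reflected. *)
Lemma ufd_iso (A B : idomainType) (f : {rmorphism A -> B}) (g : B -> A) :
  cancel f g -> cancel g f -> ufd B -> ufd A.
Proof.
move=> fK gK [[N [NM N0]] irrP].
have f_eq0 a : (f a == 0) = (a == 0).
  by rewrite -(inj_eq (can_inj fK)) rmorph0.
have fU a : (f a \is a GRing.unit) = (a \is a GRing.unit).
  apply/idP/idP; last exact: rmorph_unit.
  move=> /unitrP[y [ya ay]]; apply/unitrP; exists (g y).
  by split; apply: (can_inj fK); rewrite rmorphM gK ?ya ?ay rmorph1.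
have fdiv a b : divides (f a) (f b) <-> divides a b.
  split=> [[c bE]|[c ->]]; last by exists (f c); rewrite rmorphM.
  by exists (g c); apply: (can_inj fK); rewrite rmorphM gK.
split.
  exists (N \o f); split=> [a b a0 b0|a a0] /=.
    by rewrite rmorphM NM ?f_eq0.
  by rewrite -fU; apply: N0; rewrite f_eq0.
move=> a [a0 aU airr].
have [|_ _ fprime] := irrP (f a).
  split=> [||b c fab]; rewrite ?f_eq0 ?fU //.
  have := airr (g b) (g c); rewrite -!fU !gK; apply.
  by apply: (can_inj fK); rewrite rmorphM !gK.
by split=> // b c; rewrite -!fdiv rmorphM; apply: fprime.
Qed.

(** * Gauss's lemma and factoriality of R[X] *)

Section Gauss.
Variable R : idomainType.
Implicit Types (p c : R) (f g h q : {poly R}).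

Lemma scale_polyI c : c != 0 -> injective (fun f => c *: f).
Proof.
by move=> c0 f g; rewrite -!mul_polyC; apply: mulfI; rewrite polyC_eq0.
Qed.

Lemma divides_polyC p f :
  divides p%:P f <-> forall i, divides p f`_i.
Proof.
split=> [[q ->] i|]; first by exists q`_i; rewrite coefMC.
elim/poly_ind: f => [|f c IH] pf; first by exists 0; rewrite mul0r.
have [i|q ->] := IH.
  by have := pf i.+1; rewrite coefD coefMX coefC addr0.
have [x] := pf 0%N; rewrite coefD coefMX coefC add0r /= => ->.
by exists (q * 'X + x%:P); rewrite polyCM mulrDl mulrAC.
Qed.

Lemma unit_polyC c : (c%:P \is a GRing.unit) = (c \is a GRing.unit).
Proof.
rewrite poly_unitE coefC size_polyC; have [->|] := eqVneq c 0; by rewrite ?unitr0.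
Qed.

Lemma prime_polyC p : prime_elt p -> prime_elt p%:P.
Proof.
move=> [p0 pU pP]; split; rewrite ?polyC_eq0 ?unit_polyC //.
have dX f : divides p%:P (f * 'X) -> divides p%:P f.
  rewrite !divides_polyC => pf i; have := pf i.+1.
  by rewrite coefMX.
elim/poly_ind=> [|f c IHf] g; first by left; exists 0; rewrite mul0r.
elim/poly_ind: g => [|g e IHg] pfg; first by right; exists 0; rewrite mul0r.
have pce : divides p (c * e).
  have := (divides_polyC _ _).1 pfg 0%N.
  by rewrite -!horner_coef0 !hornerE.
have dC x : divides p x -> divides p%:P x%:P.
  by case=> y ->; exists y%:P; rewrite polyCM.
case: (pP _ _ pce) => /dC pd.
  have [|pf|] := IHf (g * 'X + e%:P); last by right.
    apply: dX; rewrite mulrAC.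
    have -> : f * 'X * (g * 'X + e%:P) =
      (f * 'X + c%:P) * (g * 'X + e%:P) - c%:P * (g * 'X + e%:P).
      by rewrite [(_ + _) * _]mulrDl addrK.
    by apply: divides_sub => //; apply: divides_mulr.
  by left; apply: divides_add => //; apply: divides_mulr.
have [|pg|pg] := IHg; last by right; apply: divides_add => //; apply: divides_mulr.
  apply: dX; rewrite -mulrA.
  have -> : (f * 'X + c%:P) * (g * 'X) =
    (f * 'X + c%:P) * (g * 'X + e%:P) - (f * 'X + c%:P) * e%:P.
    by rewrite [_ * (_ + _)]mulrDr addrK.
  by apply: divides_sub => //; apply: divides_mull.
by left.
Qed.

Hypothesis factR : ufd R.

(** The primes of [c] are cancelled one by one: each stays prime in R[X] and does not divide [f], so
    it divides [q]. *)
Lemma divides_primitive c f h q : c != 0 ->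
  (forall p, prime_elt p -> ~ divides p%:P f) ->
  c *: h = f * q -> divides f h.
Proof.
move=> c0 fprim; move: c c0 q; apply: (ufd_ind factR).
  move=> u uU q uh; exists (u^-1 *: q).
  by rewrite -scalerAl [q * f]mulrC -uh scalerA mulVr ?scale1r.
move=> p c pp c0 IH q pch.
have [p0 _ _] := pp; have [_ _ pP] := prime_polyC pp.
have [|/(fprim _ pp)//|[q1 qE]] := pP f q.
  by exists (c *: h); rewrite -pch [RHS]mulrC mul_polyC scalerA.
apply: (IH q1); apply: (scale_polyI p0); rewrite scalerA pch qE.
by rewrite mulrA mulrC mul_polyC.
Qed.

(** Gauss's lemma, with [c] as common denominator: a factorization over the fraction field descends
    to R[X] after rescaling the factors. Each prime of [c] divides [g] or [h] and is removed
    there. *)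
Lemma factor_primitive c f g h : c != 0 -> c *: f = g * h ->
  exists g' h' a b, [/\ a != 0, b != 0, f = g' * h', a *: g' = g & b *: h' = h].
Proof.
move=> c0; move: c c0 g h; apply: (ufd_ind factR).
  move=> u uU g h ufgh; exists (u^-1 *: g), h, u, 1.
  split; rewrite ?oner_neq0 ?scale1r ?scalerA ?divrr ?scale1r //.
    by apply: contraTneq uU => ->; rewrite unitr0.
  by rewrite -scalerAl -ufgh scalerA mulVr ?scale1r.
move=> p c pp c0 IH g h pcf.
have [p0 _ _] := pp; have [_ _ pP] := prime_polyC pp.
have [|[g1 gE]|[h1 hE]] := pP g h.
- by exists (c *: f); rewrite -pcf [RHS]mulrC mul_polyC scalerA.
- have [|g' [h' [a [b [a0 b0 fE gE' hE']]]]] := IH g1 h.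
    apply: (scale_polyI p0); rewrite scalerA pcf gE.
    by rewrite -mulrA mulrCA mul_polyC.
  exists g', h', (p * a), b; split; rewrite ?mulf_neq0 //.
  by rewrite -scalerA gE' gE mulrC mul_polyC.
- have [|g' [h' [a [b [a0 b0 fE gE' hE']]]]] := IH g h1.
    apply: (scale_polyI p0); rewrite scalerA pcf hE.
    by rewrite mulrA mulrC mul_polyC.
  exists g', h', a, (p * b); split; rewrite ?mulf_neq0 //.
  by rewrite -scalerA hE' hE mulrC mul_polyC.
Qed.

(** For nonconstant [f], the gcd of [f] and [g] is up to constants a factor of [f]. By
    irreducibility it is associated to [f], which then divides [g], or constant, and then [f]
    divides [h] by coprimality. *)
Lemma irreducible_prime_poly f : irreducible_elt f -> prime_elt f.
Proof.
move=> [f0 fU firr]; have [sf|sf] := leqP (size f) 1.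
  have fE := size1_polyC sf; set c := f`_0 in fE.
  rewrite fE; apply: prime_polyC; case: factR => _; apply; split.
  - by rewrite -polyC_eq0 -fE.
  - by rewrite -unit_polyC -fE.
  by move=> a b cab; rewrite -!unit_polyC; apply: firr; rewrite fE cab polyCM.
have fprim p : prime_elt p -> ~ divides p%:P f.
  move=> [p0 pU _] [q fE]; case: (firr _ _ fE).
    rewrite poly_unitE => /andP[/eqP sq _].
    by have := sf; rewrite fE mulrC mul_polyC size_scale // sq.
  by rewrite unit_polyC (negPf pU).
(* [%|] is divisibility up to a nonzero constant, which primitivity of [f] removes. *)
have fdiv h : f %| h -> divides f h.
  case/Pdiv.WeakIdomain.dvdpP => -[c q] /= c0 cE.
  by apply: (divides_primitive c0 fprim (q := q)); rewrite mulrC.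
split=> // g h [q gh].
have fgh : f %| g * h by rewrite gh dvdp_mull.
have /Pdiv.WeakIdomain.dvdpP[[c q'] /= c0 cE] := dvdp_gcdl f g.
have [a [b [x [y [x0 y0 fE aE bE]]]]] := factor_primitive c0 cE.
case: (firr _ _ fE); rewrite poly_unitE => /andP[/eqP s1 _].
- left; apply: fdiv; apply: dvdp_trans (dvdp_gcdr f g).
  rewrite -bE fE dvdpZr // (size1_polyC (eq_leq s1)).
  rewrite mul_polyC dvdpZl //.
  by apply/eqP=> a0; have := s1;
    rewrite (size1_polyC (eq_leq s1)) a0 size_polyC eqxx.
right; apply: fdiv; rewrite -(@Gauss_dvdpr _ h g f) //.
by rewrite coprimep_def -bE size_scale // s1.
Qed.

Lemma ufd_poly : ufd {poly R}.
Proof.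
split; last exact: irreducible_prime_poly.
case: factR => -[N [NM N0]] _.
(* Degree and leading coefficient both behave well under products; norm zero forces a constant that
   is a unit of R. *)
exists (fun f => ((size f).-1 + N (lead_coef f))%N); split=> [f g f0 g0|f f0].
  rewrite lead_coefM NM ?lead_coef_eq0 // size_mul // addnACA; congr (_ + _)%N.
  by rewrite -(prednK (n := size f)) ?size_poly_gt0 //
    -(prednK (n := size g)) ?size_poly_gt0 // addSn addnS.
move=> /eqP; rewrite addn_eq0 => /andP[/eqP sf /eqP Nf].
have s1 : size f = 1 by move: f0 sf; rewrite -size_poly_gt0; case: size => [|[]].
rewrite poly_unitE s1 eqxx /=.
have <- : lead_coef f = f`_0 by rewrite lead_coefE s1.
by apply: N0; rewrite ?lead_coef_eq0.
Qed.

End Gauss.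

(** * Polynomials in several variables, by adjoining the last variable *)

Section MPolyUFD.
Variable k : fieldType.

Lemma mpoly_morph_ext (n : nat) (A : comNzRingType)
    (f g : {rmorphism {mpoly k[n]} -> A}) :
  (forall c, f c%:MP = g c%:MP) -> (forall i, f 'X_i = g 'X_i) -> f =1 g.
Proof.
move=> fgC fgX; elim/mpolyind => [|c m p _ _ fgp]; first by rewrite !rmorph0.
rewrite !rmorphD fgp -mul_mpolyC !rmorphM fgC mpolyXE_id !rmorph_prod.
by congr (_ * _ + _); apply: eq_bigr => i _; rewrite !rmorphXn fgX.
Qed.

Section Muni.
Variable n : nat.
Local Notation widen := (widen_ord (leqnSn n)).

Lemma muniX_widen (i : 'I_n) : muni ('X_(widen i) : {mpoly k[n.+1]}) = ('X_i)%:P.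
Proof.
rewrite muniE msuppX big_seq1 mcoeffX eqxx scale1r.
have -> : [multinom (U_(widen i) (widen j))%MM | j < n] = U_(i)%MM.
  by apply/mnmP=> j; rewrite mnmE !mnm1E.
by rewrite mnm1E -val_eqE /= ltn_eqF // -mul_polyC mulr1.
Qed.

Lemma muniX_max : muni ('X_ord_max : {mpoly k[n.+1]}) = 'X.
Proof.
rewrite muniE msuppX big_seq1 mcoeffX eqxx scale1r.
have -> : [multinom (U_(ord_max) (widen j))%MM | j < n] = 0%MM.
  by apply/mnmP=> j; rewrite mnmE mnm1E mnm0E -val_eqE /= gtn_eqF.
by rewrite mnm1E eqxx mpolyX0 scale1r.
Qed.

Lemma mwidenX1 (i : 'I_n) : mwiden ('X_i : {mpoly k[n]}) = 'X_(widen i).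
Proof. by rewrite mwidenX mnmwiden1. Qed.

Lemma muni_mwiden (p : {mpoly k[n]}) : muni (mwiden p) = p%:P.
Proof.
apply: (mpoly_morph_ext (f := @muni n k \o @mwiden n k) (g := polyC)) p.
  by move=> c /=; rewrite mwidenC muniC.
by move=> i /=; rewrite mwidenX1 muniX_widen.
Qed.

Definition muni_inv (q : {poly {mpoly k[n]}}) : {mpoly k[n.+1]} :=
  (map_poly (@mwiden n k) q).['X_ord_max].

Lemma muni_invK : cancel muni_inv (@muni n k).
Proof.
elim/poly_ind=> [|q c IH]; first by rewrite /muni_inv rmorph0 horner0 muni0.
rewrite /muni_inv rmorphD rmorphM /= map_polyX map_polyC /= !hornerE.
by rewrite muniD muniM IH muniX_max muni_mwiden.
Qed.

Lemma muniK : cancel (@muni n k) muni_inv.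
Proof.
apply: (mpoly_morph_ext (g := idfun)
  (f := horner_eval 'X_ord_max \o map_poly (@mwiden n k) \o @muni n k)).
  by move=> c; rewrite /= muniC map_polyC /= /horner_eval hornerC mwidenC.
move=> i /=; rewrite /horner_eval; case: (unliftP ord_max i) => [j|] ->.
  have -> : lift ord_max j = widen j by apply: val_inj; exact: lift_max.
  by rewrite muniX_widen map_polyC hornerC /= mwidenX1.
by rewrite muniX_max map_polyX hornerX.
Qed.

End Muni.

Lemma ufd_mpoly (n : nat) : ufd {mpoly k[n]}.
Proof.
elim: n => [|n IH]; last first.
  exact: ufd_iso (@muniK n) (@muni_invK n) (ufd_poly IH).
(* Without variables the ring is the field k: the zero norm serves and there are no irreducible
   elements. *)
have unit0 (p : {mpoly k[0]}) : p != 0 -> p \is a GRing.unit.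
  have -> : p = (p@_0)%:MP.
    apply/mpolyP=> m; have -> : m = 0%MM by apply/mnmP=> -[].
    by rewrite mcoeffC eqxx mulr1.
  rewrite mpolyC_eq0 => p0; apply: rmorph_unit.
  by rewrite unitfE.
split; first by exists (fun=> 0%N); split=> // p p0 _; apply: unit0.
by move=> p [p0 pU _]; rewrite unit0 in pU.
Qed.

End MPolyUFD.

(** * Saito's criterion *)

Section SquarefreeGradient.
Variables (k : fieldType) (n : nat).
Local Notation R := {mpoly k[n]}.
Implicit Types p f g : R.

Lemma msize_mderiv i p : p != 0 -> (msize p^`M(i) < msize p)%N.
Proof.
move=> p0; rewrite (mpolySpred _ p0) ltnS msizeE.
apply/bigmax_leqP_seq => m; rewrite mcoeff_msupp mcoeff_mderiv => pm _.
have : (m + U_(i))%MM \in msupp p.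
  by rewrite mcoeff_msupp; apply: contraNneq pm => ->; rewrite mul0rn.
by move/msize_mdeg_lt; rewrite mdegD mdeg1 addn1 (mpolySpred _ p0).
Qed.

(** A nonzero multiple of [p] has at least the degree of [p]. Here [msize] is the total degree plus
    one. *)
Lemma not_divides_mderiv i p : p^`M(i) != 0 -> ~ divides p p^`M(i).
Proof.
move=> dp [c dE].
have p0 : p != 0 by apply: contraNneq dp => ->; rewrite mderiv0.
have c0 : c != 0 by apply: contraNneq dp => c0; rewrite dE c0 mul0r.
have := msize_mderiv i p0; rewrite dE msizeM // (mpolySpred _ c0) addSn /=.
by rewrite ltnNge leq_addl.
Qed.

Hypothesis char0 : [pchar k] =i pred0.

(** The derivative in direction i multiplies the coefficient of [m] by [m i], which is nonzero in k
    when [m i] is positive. If all derivatives vanish, [p] is therefore constant. *)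
Lemma mderiv_neq0 p : p != 0 -> p \isn't a GRing.unit ->
  exists i, p^`M(i) != 0.
Proof.
move=> p0 pU; apply/existsP; apply: contraNT pU => /existsPn dp.
have pE : p = (p@_0)%:MP.
  apply/mpolyP=> m; rewrite mcoeffC; case: (eqVneq 0%MM m) => [<-|m0].
    by rewrite mulr1.
  rewrite mulr0.
  have [i mi] : exists i, m i != 0%N.
    apply/existsP; apply: contraNT m0 => /existsPn mi.
    by apply/eqP/mnmP=> i; rewrite mnm0E; apply/esym/eqP/negPn.
  have /negPn/eqP/(congr1 (mcoeff (m - U_(i)))) := dp i.
  rewrite mcoeff_mderiv mcoeff0 submK ?lep1mP // => /eqP.
  by rewrite -mulr_natr mulf_eq0 ((pcharf0P k).1 char0) orbF => /eqP.
rewrite pE mpolyC_eq0 in p0; rewrite pE; apply: rmorph_unit.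
by rewrite unitfE.
Qed.

(* Each prime factor p of f divides f exactly once, so modulo p the gradient of
   f is a multiple prime to p of the gradient of p, which is nonzero of smaller
   degree than p. *)
Lemma squarefree_divides f g : squarefree f ->
  (forall i, divides f (g * f^`M(i))) -> divides f g.
Proof.
(* The factorization 0 = 0 ^+ 2 * 0 would make 0 a unit. *)
move=> sf; have f0 : f != 0.
  by apply/eqP=> f0; have := sf 0 0; rewrite mulr0 f0 unitr0 => /(_ erefl).
move: f f0 sf g; apply: (ufd_ind (@ufd_mpoly k n)).
  by move=> u uU _ g _; exists (g / u); rewrite divrK.
move=> p f [p0 pU pP] f0 IH sf g fg.
have sf' : squarefree f.
  by move=> x y fE; apply: (sf x (p * y)); rewrite fE mulrCA.
have [i di] := mderiv_neq0 p0 pU.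
have npf : ~ divides p f.
  case=> y fE; case/negP: pU; apply: (sf p y).
  by rewrite fE mulrCA expr2 mulrC.
have pg : divides p g.
  have : divides p ((g * p^`M(i)) * f).
    have -> : g * p^`M(i) * f = g * (p * f)^`M(i) - g * f^`M(i) * p.
      by rewrite mderivM mulrDr !mulrA -!mulrA [f^`M(i) * p]mulrC addrK.
    apply: divides_sub; last exact/divides_mull/divides_refl.
    by apply: divides_trans (fg i); exists f; rewrite mulrC.
  by case/pP=> // /pP[] // /(not_divides_mderiv di).
case: pg fg => g1 -> fg.
(* Cancelling [p] shows that [f] divides g1 times each derivative of p f, hence also g1 p times each
   derivative of [f]. So f divides g1 p by induction, with quotient [t]; as [p] does not divide [f],
   it divides [t]. *)
have [j|t tE] := IH sf' (g1 * p).
  have [c] := fg j; rewrite mderivM => cE.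
  have -> : g1 * p * f^`M(j) = g1 * (p^`M(j) * f + p * f^`M(j))
      - g1 * p^`M(j) * f by rewrite mulrDr !mulrA [X in X - _]addrC addrK.
  apply: divides_sub; last exact/divides_mull/divides_refl.
  exists c; apply: (mulfI p0); rewrite mulrA [p * g1]mulrC cE.
  exact: mulrCA.
have : divides p (t * f) by exists g1.
case/pP=> // -[y yE]; exists y; rewrite tE yE.
by rewrite -mulrA.
Qed.

End SquarefreeGradient.

Section Saito.
Variables (k : fieldType) (n : nat).
Hypothesis char0 : [pchar k] =i pred0.
Local Notation R := {mpoly k[n]}.
Implicit Types (A : 'M[R]_n) (f g : R) (v : 'I_n -> R).

Definition vector_field v g : R := \sum_i v i * g^`M(i).

Lemma vector_field_linear v : linear (vector_field v).
Proof.
move=> c f g; rewrite /vector_field scaler_sumr -big_split /=.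
apply: eq_bigr => i _; rewrite mderivD mderivZ mulrDr.
by rewrite -[in LHS]mul_mpolyC mulrCA mul_mpolyC.
Qed.

Lemma vector_fieldM v f g :
  vector_field v (f * g) = vector_field v f * g + f * vector_field v g.
Proof.
rewrite /vector_field mulr_suml mulr_sumr -big_split /=.
by apply: eq_bigr => i _; rewrite mderivM mulrDr -!mulrA;
  congr (_ + _); rewrite mulrCA.
Qed.

Lemma vector_field_derivation v : derivation (vector_field v).
Proof. by split; [apply: vector_field_linear | apply: vector_fieldM]. Qed.

Lemma mderivX1 (i j : 'I_n) : ('X_i : R)^`M(j) = (i == j)%:R.
Proof.
rewrite mderivX mnm1E; have [->|_] := eqVneq i j; last by rewrite scale0r.
have -> : (U_(j) - U_(j) = 0)%MM by apply/mnmP=> l; rewrite mnmE subnn mnm0E.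
by rewrite scale1r mpolyX0.
Qed.

Lemma vector_fieldX v i : vector_field v 'X_i = v i.
Proof.
rewrite /vector_field (bigD1 i) //= mderivX1 eqxx mulr1 big1 ?addr0 // => j.
by rewrite eq_sym mderivX1 => /negPf ->; rewrite mulr0.
Qed.

(** Both kill 1, so the Leibniz rule gives equality on monomials and linearity does the rest. *)
Lemma derivation_ext (chi1 chi2 : R -> R) : derivation chi1 -> derivation chi2 ->
  (forall i, chi1 'X_i = chi2 'X_i) -> chi1 =1 chi2.
Proof.
move=> [L1 D1] [L2 D2] chiX.
have der1 (chi : R -> R) : (forall f g, chi (f * g) = chi f * g + f * chi g) ->
    chi 1 = 0.
  move=> D; have /eqP := D 1 1; rewrite !mulr1 mul1r.
  by rewrite -subr_eq subrr eq_sym => /eqP.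
have chiM f g : chi1 f = chi2 f -> chi1 g = chi2 g ->
    chi1 (f * g) = chi2 (f * g) by rewrite D1 D2 => -> ->.
have chi_m m : chi1 'X_[m] = chi2 'X_[m].
  rewrite mpolyXE_id; elim/big_ind: _ => // [|i _]; first by rewrite !der1.
  by elim: (m i) => [|e IH]; rewrite ?expr0 ?der1 // exprS; apply: chiM.
have chi0 (chi : R -> R) : linear chi -> chi 0 = 0.
  move=> L; have := L (-1) 0 0; rewrite scaler0 addr0 scaleN1r.
  by rewrite addrC subrr.
elim/mpolyind => [|c m p _ _ IH]; first by rewrite !chi0.
by rewrite L1 L2 IH chi_m.
Qed.

Lemma derivationE (chi : R -> R) : derivation chi ->
  chi =1 vector_field (fun i => chi 'X_i).
Proof.
move=> der; apply: derivation_ext => // [|i]; last by rewrite vector_fieldX.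
exact: vector_field_derivation.
Qed.

(* A is the matrix of the fields; replacing one of its columns by [v] gives a
   matrix B whose columns are all logarithmic, so that the gradient of f times
   B, hence also times det B, is divisible by f. *)
Lemma logarithmic_det A v :
  (forall j, divides (\det A) (vector_field (A^~ j) (\det A))) ->
  divides (\det A) (vector_field v (\det A)) -> squarefree (\det A) ->
  forall j, divides (\det A) (\sum_i v i * cofactor A i j).
Proof.
set f := \det A => logA logv sf j.
pose B : 'M[R]_n := \matrix_(a, b) if b == j then v a else A a b.
(* Expansion along column j, whose cofactors do not see the replaced column. *)
have -> : \sum_i v i * cofactor A i j = \det B.
  rewrite (expand_det_col B j); apply: eq_bigr => i _; rewrite mxE eqxx.
  congr (_ * (_ * \det _)); apply/matrixP=> a b; rewrite !mxE.
  by rewrite eq_sym (negPf (neq_lift _ _)).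
apply: squarefree_divides => // i.
pose s : 'rV[R]_n := \row_i f^`M(i).
have -> : \det B * f^`M(i) = \sum_l (s *m B) 0 l * \adj B l i.
  transitivity ((s *m B *m \adj B) 0 i); last by rewrite mxE.
  by rewrite -mulmxA mul_mx_adj mul_mx_scalar !mxE.
apply: divides_sum => l; apply: divides_mulr.
have -> : (s *m B) 0 l = vector_field (B^~ l) f.
  by rewrite mxE; apply: eq_bigr => a _; rewrite mxE mulrC.
rewrite /vector_field; have [->|lj] := eqVneq l j.
  by under eq_bigr do rewrite mxE eqxx; apply: logv.
by under eq_bigr do rewrite mxE (negPf lj); apply: logA.
Qed.

Lemma Saito_criterion A :
  (forall j, divides (\det A) (vector_field (A^~ j) (\det A))) ->
  squarefree (\det A) ->
  module_basis (Der_log (principal (\det A))) (fun j => vector_field (A^~ j)).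
Proof.
move=> logA sf; set f := \det A.
have f0 : f != 0.
  by apply/eqP=> f0; have := sf 0 0; rewrite -/f mulr0 f0 unitr0 => /(_ erefl).
split=> [j|chi [der chif]].
  split; first exact: vector_field_derivation.
  move=> g [h ->]; rewrite /principal vector_fieldM.
  by apply: divides_add; [exact/divides_mull/divides_refl|exact/divides_mull/logA].
pose v : 'cV[R]_n := \col_i chi 'X_i.
(* Cramer's rule: the entries of [\adj A *m v] are the determinants of [logarithmic_det], and their
   quotients by [f] are the sought coefficients. *)
have /fin_all_exists[c cE] : forall j, exists c, (\adj A *m v) j 0 = c * f.
  move=> j; rewrite mxE.
  have := @logarithmic_det A (fun i => chi 'X_i) logA _ sf j.
  case=> [|c cE].
    by rewrite -derivationE //; apply: chif; exists 1; rewrite mul1r.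
  by exists c; rewrite -cE; apply: eq_bigr => i _; rewrite !mxE mulrC.
have combE (c' : 'I_n -> R) : (forall g, chi g =
    \sum_j c' j * vector_field (A^~ j) g) <-> A *m (\col_j c' j) = v.
  split=> [chiE|Av g].
    apply/colP=> i; rewrite !mxE chiE; apply: eq_bigr => j _.
    by rewrite mxE vector_fieldX mulrC.
  rewrite derivationE // /vector_field; under [RHS]eq_bigr do rewrite mulr_sumr.
  rewrite exchange_big /=; apply: eq_bigr => i _.
  have /colP/(_ i) := Av; rewrite !mxE => <-; rewrite mulr_suml.
  by apply: eq_bigr => j _; rewrite mxE mulrA [A i j * _]mulrC.
have Av : A *m (\col_j c j) = v.
  have fI : injective (fun w : 'cV[R]_n => f *: w).
    move=> x y /colP xy; apply/colP=> i; apply: (mulfI f0).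
    by have := xy i; rewrite !mxE.
  apply: fI; rewrite /= -[RHS]mul_scalar_mx -mul_mx_adj -mulmxA scalemxAr.
  by congr (_ *m _); apply/colP=> j; rewrite cE !mxE mulrC.
exists [ffun j => c j]; split.
  apply/combE; rewrite -Av; congr (_ *m _); apply/colP=> j.
  by rewrite !mxE ffunE.
(* Multiplying A c = A c' by [\adj A] gives f c = f c', and [f] is cancelled. *)
move=> c' /combE Ac'; apply/ffunP=> j; rewrite ffunE.
have /colP/(_ j) : f *: (\col_j c j) = f *: (\col_j c' j).
  rewrite -!mul_scalar_mx -mul_adj_mx -!mulmxA Av.
  by rewrite -Ac'.
by rewrite !mxE => /(mulfI f0).
Qed.

End Saito.

(** * Semi-invariance of the discriminant *)

Section DerivationDet.
Variables (R : comNzRingType) (delta : {additive R -> R}).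
Hypothesis deltaM : forall f g, delta (f * g) = delta f * g + f * delta g.

Lemma derivation_prod (n : nat) (F : 'I_n -> R) :
  delta (\prod_j F j) =
  \sum_i \prod_j (if j == i then delta (F j) else F j).
Proof.
elim: n F => [|n IH] F.
  rewrite !big_ord0; have /eqP := deltaM 1 1; rewrite !mulr1 mul1r.
  by rewrite -subr_eq subrr eq_sym => /eqP.
rewrite big_ord_recl deltaM IH mulr_sumr [RHS]big_ord_recl; congr (_ + _).
  by rewrite big_ord_recl eqxx.
by apply: eq_bigr => i _; rewrite [RHS]big_ord_recl.
Qed.

(** Jacobi's formula: [delta] hits one row at a time, and the determinant of the matrix [B i] with
    row i differentiated is expanded along that row. *)
Lemma derivation_det (n : nat) (A : 'M[R]_n) :
  delta (\det A) = \sum_i \sum_j delta (A i j) * cofactor A i j.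
Proof.
pose B i : 'M[R]_n := \matrix_(a, b) if a == i then delta (A a b) else A a b.
transitivity (\sum_i \det (B i)).
  rewrite /determinant exchange_big raddf_sum; apply: eq_bigr => s _ /=.
  rewrite raddfMsign derivation_prod mulr_sumr; apply: eq_bigr => i _.
  by congr (_ * _); apply: eq_bigr => j _; rewrite mxE.
apply: eq_bigr => i _; rewrite (expand_det_row (B i) i); apply: eq_bigr => j _.
rewrite mxE eqxx; congr (_ * (_ * \det _)); apply/matrixP=> a b; rewrite !mxE.
by rewrite eq_sym (negPf (neq_lift _ _)).
Qed.

(** By Jacobi's formula the left side is the trace of (M A + A C) times [\adj A]. Cyclicity of the
    trace brings [A] next to its adjugate in both terms. *)
Lemma det_semi_invariant (n : nat) (A M C : 'M[R]_n) :
  map_mx delta A = M *m A + A *m C ->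
  delta (\det A) = (\tr M + \tr C) * \det A.
Proof.
move=> dA; rewrite derivation_det.
transitivity (\tr (map_mx delta A *m \adj A)).
  by apply: eq_bigr => i _; rewrite mxE; apply: eq_bigr => j _; rewrite !mxE.
rewrite dA mulmxDl mxtraceD -mulmxA mul_mx_adj mul_mx_scalar mxtraceZ.
rewrite mxtrace_mulC mulmxA mul_adj_mx mul_scalar_mx mxtraceZ.
by rewrite -mulrDr mulrC.
Qed.

End DerivationDet.

HB.instance Definition _ (k : fieldType) (n : nat) (v : 'I_n -> {mpoly k[n]}) :=
  GRing.isLinear.Build k {mpoly k[n]} {mpoly k[n]} _ (vector_field v)
    (vector_field_linear v).

(** * The infinitesimal action of gl(Q,d) on representations *)

Section RepAction.
Variables (R : comNzRingType) (Q : quiver) (d : dimvec Q).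
Implicit Types (psi : gl R d) (V : Rep R d).

Definition rep_action psi V : Rep R d :=
  fun a => psi (Defs.head a) *m V a - V a *m psi (tail a).

Definition gl_bracket psi phi : gl R d :=
  fun x => psi x *m phi x - phi x *m psi x.

(** The action is a homomorphism of Lie algebras. *)
Lemma rep_action_bracket psi phi V a :
  rep_action psi (rep_action phi V) a =
  rep_action phi (rep_action psi V) a + rep_action (gl_bracket psi phi) V a.
Proof.
rewrite /rep_action /gl_bracket !(mulmxBl, mulmxBr) !mulmxA.
move: (psi _ *m phi _ *m V a) (psi _ *m V a *m phi _) (phi _ *m V a *m psi _)
  (V a *m phi _ *m psi _) (phi _ *m psi _ *m V a) (V a *m psi _ *m phi _).
by move=> *; apply/matrixP=> i j; rewrite !mxE; ring.
Qed.

(** The standard basis of Rep(Q,d). Comparing tagged pairs avoids casts between the matrix types of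
    different arrows. *)
Definition delta_rep (s : 'I_(ncoord d)) : Rep R d :=
  fun a => \matrix_(i, j)
    (Tagged (fun a => 'I_(d (Defs.head a)) * 'I_(d (tail a)))%type (i, j)
      == enum_val s)%:R.

Lemma rep_delta V a : V a = \sum_s coords V s *: delta_rep s a.
Proof.
apply/matrixP=> i j; rewrite summxE.
set c : Defs.coord d :=
  Tagged (fun a => 'I_(d (Defs.head a)) * 'I_(d (tail a)))%type (i, j).
rewrite (bigD1 (enum_rank c)) //= !mxE enum_rankK eqxx mulr1 big1 ?addr0.
  by rewrite /coords enum_rankK.
move=> s sc; rewrite !mxE; case: eqP => [cE|_]; last by rewrite mulr0.
by move: sc; rewrite /c cE enum_valK eqxx.
Qed.

(** The action is linear in [V]; this supplies the left factor M of [det_semi_invariant]. *)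
Lemma rep_action_matrix psi : exists M : 'M[R]_(ncoord d), forall V r,
  coords (rep_action psi V) r = \sum_s M r s * coords V s.
Proof.
exists (\matrix_(r, s) coords (rep_action psi (delta_rep s)) r) => V r.
rewrite {1}/coords /entry /rep_action rep_delta mulmx_sumr mulmx_suml -sumrB.
rewrite summxE; apply: eq_bigr => s _.
rewrite -scalemxAr -scalemxAl -scalerBr !mxE mulrC; congr (_ * _).
by rewrite /coords /entry /rep_action !mxE.
Qed.

End RepAction.

(** * The linear vector fields of the action and their determinant *)

Section Discriminant.
Variables (k : fieldType) (Q : quiver) (d : dimvec Q).
Local Notation N := (ncoord d).
Local Notation R := (coord_ring k d).
Local Notation X := (universal_rep k d).

Lemma dMM_homog (psi : gl k d) (r : 'I_N) :
  coords (dMM (gl_extend psi)) r \is 1.-homog.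
Proof.
have XE a i j : X a i j \is 1.-homog by rewrite mxE dhomogX /= mdeg1.
rewrite /coords /entry /dMM /gl_extend !mxE; apply: rpredB; apply: rpred_sum => s _.
  by rewrite mxE mul_mpolyC; apply: dhomogZ.
by rewrite [map_mx _ _ _ _]mxE mulrC mul_mpolyC; apply: dhomogZ.
Qed.

(** The entries of [dMM] are linear forms with constant coefficients, so applying the field replaces
    each coordinate function by its component, that is, the universal representation by [V]. *)
Lemma vector_field_dMM (v : 'I_N -> R) (V : Rep R d) (psi : gl k d) r :
  (forall s, v s = coords V s) ->
  vector_field v (coords (dMM (gl_extend psi)) r) =
  coords (rep_action (gl_extend psi) V) r.
Proof.
move=> vV; rewrite /coords; case: (enum_val r) => a [i j]; rewrite /entry /=.
have XV x y : vector_field v (X a x y) = V a x y.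
  by rewrite mxE vector_fieldX vV /coords enum_rankK.
have cX c f : vector_field v (c%:MP * f) = c%:MP * vector_field v f.
  by rewrite !mul_mpolyC linearZ.
rewrite /dMM /rep_action !mxE raddfB /=.
congr (_ - _); rewrite [LHS]raddf_sum; apply: eq_bigr => s _ /=.
  by rewrite [gl_extend _ _ _ _]mxE cX XV.
by rewrite [gl_extend _ _ _ _]mxE mulrC cX XV mulrC.
Qed.

Lemma gl_extend_bracket (psi phi : gl k d) x :
  gl_bracket (gl_extend psi) (gl_extend phi) x = gl_extend (gl_bracket psi phi) x.
Proof. by rewrite /gl_bracket /gl_extend map_mxB !map_mxM. Qed.

(** Scalars commute with the universal representation, so the term [l%:M] cancels. *)
Lemma dMM_combination (m : nat) (b : 'I_m -> gl k d) (c : 'I_m -> k) (l : k)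
    (psi : gl k d) (r : 'I_N) :
  (forall x, psi x = \sum_i c i *: b i x + l%:M) ->
  coords (dMM (gl_extend psi)) r =
  \sum_i (c i)%:MP * coords (dMM (gl_extend (b i))) r.
Proof.
move=> psiE; rewrite /coords; case: (enum_val r) => a [x y]; rewrite /entry /=.
have extE z : gl_extend psi z =
    \sum_i (c i)%:MP *: gl_extend (b i) z + (l%:MP)%:M.
  rewrite /gl_extend psiE map_mxD map_scalar_mx; congr (_ + _).
  by rewrite raddf_sum; apply: eq_bigr => i _; rewrite /= map_mxZ.
rewrite /dMM !extE mulmxDl mulmxDr mul_scalar_mx mul_mx_scalar.
rewrite opprD addrACA subrr addr0 mulmx_suml mulmx_sumr -sumrB summxE.
by apply: eq_bigr => i _; rewrite -scalemxAl -scalemxAr -scalerBr mxE.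
Qed.

Lemma discriminant_logarithmic (b : 'I_N -> gl k d) (j : 'I_N) :
  pgl_basis b ->
  divides (discriminant b)
    (vector_field ((dMM_matrix b)^~ j) (discriminant b)).
Proof.
move=> hb; set A := dMM_matrix b.
have AE r i : A r i = coords (dMM (gl_extend (b i))) r by rewrite mxE.
have [M ME] := rep_action_matrix (gl_extend (b j)).
have /fin_all_exists[c cE] : forall i, exists c : {ffun 'I_N -> k},
    exists l : k, forall x,
      gl_bracket (b i) (b j) x = \sum_s c s *: b s x + l%:M.
  by move=> i; have [c [cP _]] := hb (gl_bracket (b i) (b j)); exists c.
(* Column i of [C] holds the structure constants of pgl(Q,d) for the bracket of [b i] and [b j]. *)
pose C : 'M[R]_N := \matrix_(s, i) (c i s)%:MP.
exists (\tr M + \tr C); apply: det_semi_invariant => [f g|].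
  exact: vector_fieldM.
apply/matrixP=> r i; rewrite mxE [RHS]mxE AE [LHS]/=.
rewrite (vector_field_dMM (V := dMM (gl_extend (b j)))); last first.
  by move=> s; rewrite -AE.
(* Exchanging the two actions costs a bracket: the first summand becomes the entry of M A, the
   second that of A C. *)
transitivity (coords (rep_action (gl_extend (b j)) (dMM (gl_extend (b i)))) r
  + coords (dMM (gl_extend (gl_bracket (b i) (b j)))) r).
  rewrite /coords; case: (enum_val r) => a [x y]; rewrite /entry /=.
  have := rep_action_bracket (gl_extend (b i)) (gl_extend (b j)) X a.
  rewrite {5}/rep_action !gl_extend_bracket => /matrixP/(_ x y).
  by rewrite [in RHS]mxE.
have [l lE] := cE i; rewrite ME (dMM_combination _ lE); congr (_ + _).
  by rewrite mxE; apply: eq_bigr => s _; rewrite AE.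
by rewrite mxE; apply: eq_bigr => s _; rewrite AE mxE mulrC.
Qed.

End Discriminant.

Theorem corollary5p2 (k : closedFieldType) (hk : [pchar k] =i pred0)
    (Q : quiver) (d : dimvec Q) (hq : tits_form d = 1)
    (hgen : general (fun V : Rep k d => indecomposable V))
    (b : 'I_(ncoord d) -> gl k d) (hb : pgl_basis b)
    (hred : squarefree (discriminant b)) :
  linear_free_divisor (principal (discriminant b)).
Proof.
split.
  exists (discriminant b); split=> // b0.
  by have := hred 0 0; rewrite mulr0 b0 unitr0 => /(_ erefl).
exists (ncoord d), (fun j => vector_field ((dMM_matrix b)^~ j)); split.
  by apply: Saito_criterion => // j; apply: discriminant_logarithmic.
by move=> j i; rewrite vector_fieldX mxE dMM_homog.
Qed.
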